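(* Let $p\in(0,1)$ be a constant independent of $n$ and let $q=p^{-1}$. For every $n$ let $\{p_\sigma\}$ be a system of probability parameters $p_\sigma\in[0,1]$, one for each simplex $\sigma$ of $\Delta_n$, satisfying $p\le p_\sigma$ for all $\sigma$. Then a random simplicial complex $X\subset\Delta_n$ in the lower multi-parameter model with parameters $p_\sigma$ is $\lfloor \log_3\log_{q^2}n-1\rfloor$-connected asymptotically almost surely, i.e. with probability tending to $1$ as $n\to\infty$.
   Context: Simplexes are non-empty. $\Delta_n$ is the simplex with vertex set $[n]=\{1,\dots,n\}$, whose simplexes are all non-empty subsets of $[n]$. Lower multi-parameter model: given numbers $p_\sigma\in[0,1]$ for each simplex $\sigma$ of $\Delta_n$ (they may depend on $n$), $\mathcal P$ is the unique probability measure on the set of all simplicial subcomplexes $X\subset\Delta_n$ (the vertex set of $X$ may be a proper subset of $[n]$) such that for every subcomplex $L\subset\Delta_n$ one has $\mathcal P\{X: L\subset X\}=\prod_{\sigma\in L}p_\sigma$. A topological space $X$ is $r$-connected ($r\ge 0$) if it is non-empty and every continuous map $S^d\to X$ with $0\le d\le r$ extends to a continuous map $D^{d+1}\to X$; a simplicial complex is $r$-connected if its geometric realisation is. *)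

(* Defs.v *)
From HB Require Import structures.
From mathcomp Require Import all_boot all_order all_algebra.
From mathcomp Require Import all_classical all_reals all_analysis.
Set Implicit Arguments.
Unset Strict Implicit.
Unset Printing Implicit Defensive.
Import Order.TTheory GRing.Theory Num.Theory.
Import numFieldNormedType.Exports.
Local Open Scope classical_set_scope.
Local Open Scope ring_scope.

(* A subcomplex of Delta_n is given by its family of simplexes.  The vertices *)
(* 1, ..., n are indexed by 'I_n = {0, ..., n-1}; a point of 'I_n is a vertex *)
(* of X only if its singleton belongs to X, and X may be empty.               *)
Definition is_subcomplex (n : nat) (X : {set {set 'I_n}}) : bool :=
  [forall s in X, (s != finset.set0) &&
     [forall t : {set 'I_n}, (t != finset.set0) && (t \subset s) ==> (t \in X)]].

Record subcomplex (n : nat) : Type := Subcomplex {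
  simplexes :> {set {set 'I_n}};
  simplexesP : is_subcomplex simplexes }.

HB.instance Definition _ (n : nat) := [isSub for @simplexes n].
HB.instance Definition _ (n : nat) := [Finite of subcomplex n by <:].

Lemma is_subcomplex0 (n : nat) : @is_subcomplex n finset.set0.
Proof. by apply/forall_inP => s; rewrite inE. Qed.

HB.instance Definition _ (n : nat) :=
  isPointed.Build (subcomplex n) (Subcomplex (is_subcomplex0 n)).

Section subcomplex_measurable.
Variable n : nat.
Notation T := (subcomplex n).
HB.instance Definition _ := @isMeasurable.Build default_measure_display T
  (@discrete_measurable T) discrete_measurable0
  discrete_measurableC discrete_measurableU.
End subcomplex_measurable.

Definition lower_model (R : realType) (n : nat) (p : {set 'I_n} -> R)
    (P : probability (subcomplex n) R) : Prop :=
  forall L : subcomplex n,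
    P [set X : subcomplex n | L \subset X] = (\prod_(s in L) p s)%:E.

(* The defining property of lower_model determines a probability measure:    *)
(* it exists (keep each non-empty set s independently with probability p s    *)
(* and take the largest subcomplex made of kept sets) and it is unique.       *)
Section lower_model_existence.
Variables (R : realType) (n : nat) (p : {set 'I_n} -> R).
Hypothesis p01 : forall s, s != finset.set0 -> 0 <= p s <= 1.

Let F := {ffun {set 'I_n} -> bool}.
Let pp s := if s == finset.set0 then 1 else p s.
Let a s (b : bool) := if b then pp s else 1 - pp s.
Let w (f : F) := \prod_s a s (f s).

Let w_ge0 f : 0 <= w f.
Proof.
apply: prodr_ge0 => s _; rewrite /a /pp; case: eqVneq => [_|/p01/andP[h0 h1]].
  by case: (f s); rewrite // subrr.
by case: (f s); rewrite // subr_ge0.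
Qed.

Let faces (f : F) : {set {set 'I_n}} :=
  [set s | (s != finset.set0) &&
     [forall t : {set 'I_n}, (t != finset.set0) && (t \subset s) ==> f t]]%SET.

Let facesP f : is_subcomplex (faces f).
Proof.
apply/forall_inP => s; rewrite inE => /andP[s0 /forallP h]; rewrite s0/=.
apply/forallP => t; apply/implyP => /andP[t0 ts]; rewrite inE t0/=.
apply/forallP => u; apply/implyP => /andP[u0 ut].
by apply: (implyP (h u)); rewrite u0 (fintype.subset_trans ut).
Qed.

Let cx f := Subcomplex (facesP f).

Let sub_cx (L : subcomplex n) f :
  (L \subset cx f) = [forall s, (s \in simplexes L) ==> f s].
Proof.
have LP := forall_inP (simplexesP L).
apply/fintype.subsetP/forall_inP => [h s sL|h s sL].
  move: (h s sL); rewrite inE => /andP[s0 /forallP/(_ s)/implyP]; apply.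
  by rewrite s0 subxx.
have /andP[s0 /forallP hs] := LP s sL.
rewrite inE s0/=; apply/forallP => t; apply/implyP => ht.
by apply: h; apply: (implyP (hs t)).
Qed.

Let f0 : F := [ffun=> false].
Let nf k := nth f0 (enum F) k.
Let mu := msum (fun k => mscale (NngNum (w_ge0 (nf k))) (dirac (cx (nf k))))
   (size (enum F)).

Let muE (A : set (subcomplex n)) (b : pred F) :
  (forall f, b f = (cx f \in A)) ->
  mu A = (\sum_f w f * (b f)%:R)%:E.
Proof.
move=> hb; rewrite /mu /msum -sumEFin -[in RHS]big_enum [in RHS](big_nth f0) [in RHS]big_mkord.
by apply: eq_bigr => k _; rewrite hb EFinM.
Qed.

Let mu_sub (L : subcomplex n) :
  mu [set X : subcomplex n | L \subset X] = (\prod_(s in L) p s)%:E.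
Proof.
rewrite (@muE _ (fun f => [forall s, (s \in simplexes L) ==> f s])); last first.
  by move=> f; rewrite -sub_cx; apply/idP/idP; rewrite inE.
congr EFin.
have -> : \prod_(s in L) p s =
    \prod_s \sum_(b : bool) a s b * ((s \in simplexes L) ==> b)%:R.
  rewrite big_mkcond; apply: eq_bigr => s _; rewrite big_bool/= implybT implybF mulr1.
  case: ifPn => sL; last by rewrite mulr1 addrC subrK.
  rewrite mulr0 addr0 /pp.
  by have /andP[/negPf-> _] := forall_inP (simplexesP L) s sL.
rewrite bigA_distr_bigA/=; apply: eq_bigr => f _.
rewrite big_split/=; congr (_ * _).
case: forallP => [h|h].
  by rewrite big1// => s _; rewrite h.
apply/esym/eqP/prodf_eq0.
have /forallPn[s hs] : ~~ [forall s, (s \in simplexes L) ==> f s].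
  by apply/forallP.
by exists s => //; rewrite (negPf hs).
Qed.

Let muT : mu setT = 1%E.
Proof.
have := mu_sub (Subcomplex (is_subcomplex0 n)).
rewrite big_set0 => <-; congr (mu _); apply/seteqP; split => // X _ /=.
by apply/fintype.subsetP => s; rewrite inE.
Qed.

HB.instance Definition _ := Measure.on mu.
HB.instance Definition _ := Measure_isProbability.Build _ _ _ mu muT.

Lemma lower_model_exists : exists P : probability (subcomplex n) R, lower_model p P.
Proof. by exists mu => L; exact: mu_sub. Qed.
End lower_model_existence.

Lemma lower_model_unique (R : realType) (n : nat) (p : {set 'I_n} -> R)
  (P Q : probability (subcomplex n) R) :
  lower_model p P -> lower_model p Q -> forall A, P A = Q A.
Proof.
move=> hP hQ.
have mA (A : set (subcomplex n)) : measurable A by [].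
have sm (P' : probability (subcomplex n) R) A :
    P' A = (\sum_(X | X \in A) P' [set X])%E.
  rewrite bigfs ?index_enum_uniq//; last by move=> X; rewrite mem_index_enum.
  rewrite -measure_fin_bigcup//; last by move=> X Y _ _ [x [/= -> ->]].
  congr (P' _); apply/seteqP; split => [X XA|X [Y /= + ->]]; last by rewrite inE.
  by exists X => //=; apply/mem_set.
move=> A; rewrite !sm; apply: eq_bigr => L _ {A}.
have [k] := ubnP (#|~: simplexes L|)%SET.
elim: k L => // k IH L hk.
have e (P' : probability (subcomplex n) R) :
   P' [set X : subcomplex n | L \subset X] =
   (P' [set L] + \sum_(X : subcomplex n | simplexes L \proper simplexes X) P' [set X])%E.
  rewrite sm (bigD1 L) /=; last by rewrite inE/=.
  congr (_ + _)%E; apply: eq_bigl => X.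
  rewrite finset.properEneq andbC -val_eqE/= eq_sym; congr (_ && _).
  by apply/idP/idP; rewrite inE.
have := hP L; rewrite -(hQ L) !e.
rewrite (eq_bigr (fun X => Q [set X])); last first.
  move=> X LX; apply: IH; rewrite -ltnS (leq_trans _ hk)// ltnS.
  by apply: fintype.proper_card; rewrite finset.properC.
have fS : (\sum_(X : subcomplex n | simplexes L \proper simplexes X) Q [set X])%E
    \is a fin_num.
  by apply/sum_fin_numP => X _ _; exact: fin_num_measure.
by move=> /(congr1 (fun x => x - \sum_(X : subcomplex n |
  simplexes L \proper simplexes X) Q [set X])%E); rewrite !addeK.
Qed.

Definition realization (R : realType) (n : nat) (X : subcomplex n)
  : set 'rV[R]_n :=
  [set x | [/\ forall i, 0 <= x ord0 i, \sum_i x ord0 i = 1 &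
               [set i | x ord0 i != 0]%SET \in simplexes X]].

Definition sphere (R : realType) (d : nat) : set 'rV[R]_d.+1 :=
  [set x | \sum_i x ord0 i ^+ 2 = 1].

Arguments sphere : clear implicits.

Definition disk (R : realType) (d : nat) : set 'rV[R]_d.+1 :=
  [set x | \sum_i x ord0 i ^+ 2 <= 1].

Arguments disk : clear implicits.

(* r-connectedness of the subspace A of T.  The bound r is an integer so that *)
(* it can be the floor of a real number; for r < 0 only A !=set0 remains.     *)
Definition r_connected (R : realType) (T : topologicalType) (r : int)
    (A : set T) : Prop :=
  A !=set0 /\
  forall (d : nat) (f : 'rV[R]_d.+1 -> T), d%:Z <= r ->
    {within sphere R d, continuous f} ->
    f @` sphere R d `<=` A ->
    exists g : 'rV[R]_d.+1 -> T,
      [/\ {within disk R d, continuous g},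
          g @` disk R d `<=` A &
          forall x, sphere R d x -> g x = f x].

Definition complex_connected (R : realType) (n : nat) (r : int)
    (X : subcomplex n) : Prop :=
  @r_connected R 'rV[R]_n r (@realization R n X).

Definition log (R : realType) (b x : R) : R := ln x / ln b.

(* Main.v *)
Require Import Defs.
From HB Require Import structures.
From mathcomp Require Import all_boot all_order all_algebra.
From mathcomp Require Import all_classical all_reals all_analysis.
From mathcomp Require Import zify ring lra.
Set Implicit Arguments.
Unset Strict Implicit.
Unset Printing Implicit Defensive.
Import Order.TTheory GRing.Theory Num.Theory.
Import numFieldNormedType.Exports.
Local Open Scope classical_set_scope.
Local Open Scope ring_scope.

(* Call X M-conic if for every subcomplex L of X with fewer than M simplexes  *)
(* there is a vertex u such that the cone u * L lies in X.                    *)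
(*                                                                            *)
(* Topology: a 3^m-conic complex has the extension property for maps of the   *)
(* boundary of the m-cube.  By induction on m: cut the cube into small cubes  *)
(* Q and label each Q with a vertex v(Q) such that f maps the part of the     *)
(* boundary in Q to the star of v(Q); then extend f cell by cell, so that a   *)
(* cell of codimension k lands in the intersection of the at most 2^k stars   *)
(* of the labels of the cubes containing it.  For k = 0 a star is a cone.     *)
(* For k > 0 an intersection of 2^k stars is 3^(m-k)-conic, since coning L    *)
(* over 2^k vertices multiplies its number of faces (the empty one included)  *)
(* by at most 2^k + 1 <= 3^k, and induction applies.                          *)
(*                                                                            *)
(* Probability: given L, the vertices outside L cone L independently, each    *)
(* with probability at least p^M, which is at least n^(-1/2) for              *)
(* M = floor(log_{q^2} n); since there are at most (n+1)^(M^2) candidates L,  *)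
(* the union bound shows that, for large n, X is M-conic with probability at  *)
(* least 1 - 1/n.                                                             *)

(** * Continuity on subsets *)

(** The two halves of the argument meet in [conic M], with [M] the integer part of
    [l = log_{q^2} n]. Topologically, [S^d] is the boundary of a [(d+1)]-cube, and
    [conic_ext_sphere] fills every such boundary in a [3^(d+1)]-conic complex. Its induction on
    dimension rests on three facts: the star of one vertex is star-shaped ([ext_sphere_star]), an
    intersection of stars is conic with a controlled loss ([conic_stars]), and maps on a grid can be
    extended one cell at a time ([box_extends_cells]). [label_extends] combines them.
    Probabilistically, base [q^2] makes [p^M] at least [n^(-1/2)]. The chance that none of the at
    least [n - M] vertices outside [L] cones a given [L] is then at most [exp(-sqrt n / 2)], which
    beats the [(n+1)^(M^2) = exp(O(log^3 n))] choices of [L] ([lower_model_not_conic],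
    [union_bound_le]). The two fit because [d <= log_3 l - 1] means [3^(d+1) <= l], hence
    [3^(d+1) <= M] ([conic_log_connected]). *)

Lemma within_continuous_comp_sub {T U V : topologicalType} (A : set T)
    (B : set U) (f : T -> U) (g : U -> V) :
  {within A, continuous f} -> {within B, continuous g} ->
  (forall x, A x -> B (f x)) -> {within A, continuous (g \o f)}.
Proof.
move=> /subspace_continuousP cf /subspace_continuousP cg AB.
apply/subspace_continuousP => x Ax.
apply: cvg_trans (cg _ (AB _ Ax)) => W /= hW.
have := cf _ Ax _ hW; rewrite /nbhs/= /within/=.
by apply: filterS => y hy Ay; apply: hy => //; exact: AB.
Qed.

Lemma within_continuous_rV {R : numFieldType} {T : topologicalType} n
    (A : set T) (f : T -> 'rV[R]_n) :
  (forall i, {within A, continuous (fun x => f x ord0 i)}) ->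
  {within A, continuous f}.
Proof.
move=> h x; apply/cvg_ballP => e e0.
have : \forall y \near (x : subspace A), forall i : 'I_n,
    ball (f x ord0 i) e (f y ord0 i).
  apply: filter_forall => i.
  by have /cvg_ballP/(_ _ e0) := h i x.
apply: filterS => y hy; split => // i j; rewrite ord1; exact: hy.
Qed.

Lemma continuous_coord_affine {R : numFieldType} m (c e : R) (i : 'I_m) :
  continuous (fun x : 'rV[R]_m => c * x ord0 i + e).
Proof.
move=> y.
apply: (@continuousD R R^o _ (fun z : 'rV[R]_m => c * z ord0 i) (cst e) y);
  last exact: cst_continuous.
apply: (@continuousM R _ (cst c) (fun z : 'rV[R]_m => z ord0 i) y).
  exact: cst_continuous.
exact: coord_continuous.
Qed.

Lemma continuous_rV_affine {R : numFieldType} m n (h : 'I_n -> 'I_m)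
    (c e : 'I_n -> R) :
  continuous (fun x : 'rV[R]_m => \row_i (c i * x ord0 (h i) + e i)).
Proof.
apply/continuous_subspace_setT; apply: within_continuous_rV => i.
apply: continuous_subspaceT; rewrite (_ : (fun _ => _) =
  (fun z : 'rV[R]_m => c i * z ord0 (h i) + e i)).
  exact: continuous_coord_affine.
by apply/funext => z; rewrite mxE.
Qed.

Lemma within_continuous_paste {T U : topologicalType} (A B : set T)
    (f g : T -> U) : closed A -> closed B ->
  {within A, continuous f} -> {within B, continuous g} ->
  (forall x, A x -> B x -> f x = g x) ->
  exists h : T -> U, [/\ {within A `|` B, continuous h},
    forall x, A x -> h x = f x & forall x, B x -> h x = g x].
Proof.
move=> cA cB cf cg fg; pose h x := if x \in A then f x else g x.
have hA x : A x -> h x = f x by move=> Ax; rewrite /h mem_set.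
have hB x : B x -> h x = g x.
  by move=> Bx; rewrite /h; case: ifPn => // /set_mem Ax; exact: fg.
exists h; split => //; apply: withinU_continuous => //.
- by apply: subspace_eq_continuous cf => x /set_mem /hA.
- by apply: subspace_eq_continuous cg => x /set_mem /hB.
Qed.

(** Heine-Cantor. Each point gets a ball of half its radius [d] of [e / 2]-continuity, so that
    points within [d / 2] of the ball's members are still within [d] of its centre; the
    near-covering form of compactness then gives one radius for all. *)
Lemma compact_uniform_continuity {R : realFieldType}
    {V W : normedModType R} (A : set V) (f : V -> W) (e : R) :
  compact A -> {within A, continuous f} -> 0 < e ->
  exists2 d, 0 < d & forall x y, A x -> A y -> `|x - y| < d -> `|f x - f y| < e.
Proof.
move=> /compact_near_coveringP/near_covering_withinP cA
  /subspace_continuousP cf e0.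
have := cA R 0^'+ (fun d x => forall y, A y -> `|x - y| < d -> `|f x - f y| < e).
move=> /(_ _); case.
  move=> x Ax; have /cvgrPdist_lt /(_ (e / 2)) := cf x Ax.
  rewrite divr_gt0// => /(_ isT).
  rewrite /within/= => /nbhs_normP[d /= d0 hd].
  exists ([set x' | `|x - x'| < d / 2], [set t | t < d / 2]) => /=.
    split; first by apply/nbhs_normP; exists (d / 2) => //=; rewrite divr_gt0.
    by apply: nbhs_right_lt; rewrite divr_gt0.
  move=> [x' t]/= [h1 h2] Ax' y Ay h3.
  rewrite (splitr e) -(subrKA (f x)) (le_lt_trans (ler_normD _ _))//.
  rewrite ltrD// ?(distrC (f x')); apply: hd => //=.
    by rewrite (lt_trans h1)// ltr_pdivrMr// ltr_pMr// ltr1n.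
  rewrite -(subrKA x') (le_lt_trans (ler_normD _ _))// (splitr d) ltrD//.
  exact: lt_trans h2.
move=> r /= r0 hr; exists (r / 2); first by rewrite divr_gt0.
move=> x y Ax Ay; apply: (hr (r / 2)) => //=.
  by rewrite sub0r normrN gtr0_norm ?divr_gt0// ltr_pdivrMr// ltr_pMr// ltr1n.
by rewrite divr_gt0.
Qed.

(** * Integer boxes *)

Section boxes.
Variables (R : realType) (m : nat).
Implicit Types (a b : 'I_m -> nat) (x : 'rV[R]_m).

Definition box a b : set 'rV[R]_m :=
  [set x | forall i, (a i)%:R <= x ord0 i <= (b i)%:R].

(* The relative boundary: a coordinate in which the box is degenerate does *)
(* not contribute.                                                         *)
Definition box_bdry a b : set 'rV[R]_m :=
  [set x | box a b x /\ exists i, (a i < b i)%N /\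
    (x ord0 i = (a i)%:R \/ x ord0 i = (b i)%:R)].

Lemma closed_coord_itv (i : 'I_m) (c d : R) :
  closed [set x : 'rV[R]_m | c <= x ord0 i <= d].
Proof.
rewrite (_ : mkset _ = (fun x : 'rV[R]_m => x ord0 i) @^-1` `[c, d]%classic); last first.
  by apply/seteqP; split => x /=; rewrite in_itv.
apply: closed_comp => [x _|]; first exact: coord_continuous.
exact: interval_closed.
Qed.

Lemma closed_box a b : closed (box a b).
Proof.
rewrite (_ : box a b = \bigcap_i [set x : 'rV[R]_m | (a i)%:R <= x ord0 i <= (b i)%:R]).
  by apply: closed_bigI => i _; exact: closed_coord_itv.
by apply/seteqP; split => x h i => [_|]; [exact: h | exact: (h i Logic.I)].
Qed.

Lemma closed_box_bdry a b : closed (box_bdry a b).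
Proof.
pose F i := [set x : 'rV[R]_m | (a i)%:R <= x ord0 i <= (a i)%:R] `|`
  [set x : 'rV[R]_m | (b i)%:R <= x ord0 i <= (b i)%:R].
rewrite (_ : box_bdry a b =
  box a b `&` \bigcup_(i in [set i | (a i < b i)%N]) F i).
  apply: closedI; first exact: closed_box.
  apply: closed_bigcup; first exact: finite_finset.
  by move=> i _; apply: closedU; exact: closed_coord_itv.
apply/seteqP; split => x [xab [i]] => [[abi h]|abi h]; split => //; exists i => //.
  by rewrite /F/=; case: h => ->; rewrite lexx; [left|right].
by split => //; case: h => /= h; [left|right]; apply/eqP; rewrite eq_le andbC.
Qed.

Definition set_coord a i t : 'I_m -> nat := fun j => if j == i then t else a j.

(** The target [C] varies with the point because it is prescribed cube by cube: in [label_extends]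
    it is the intersection of the stars of the labels of all grid cubes through [x]. *)
Definition box_extends {T : topologicalType} (C : 'rV[R]_m -> set T) a b :=
  forall f : 'rV[R]_m -> T, {within box_bdry a b, continuous f} ->
  (forall x, box_bdry a b x -> C x (f x)) ->
  exists g : 'rV[R]_m -> T, [/\ {within box a b, continuous g},
    forall x, box a b x -> C x (g x) & forall x, box_bdry a b x -> g x = f x].

(* Extend to the slice x_i = t first, then to the two halves. *)
Lemma box_extends_split {T : topologicalType} (C : 'rV[R]_m -> set T) a b i t :
  (a i < t < b i)%N ->
  box_extends C (set_coord a i t) (set_coord b i t) ->
  box_extends C a (set_coord b i t) -> box_extends C (set_coord a i t) b ->
  box_extends C a b.
Proof.
move=> /andP[ait tbi] HE HL HU f cf Cf.
have aitR : (a i)%:R < t%:R :> R by rewrite ltr_nat.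
have tbiR : t%:R < (b i)%:R :> R by rewrite ltr_nat.
set E := box (set_coord a i t) (set_coord b i t).
have inE x : E x -> box a b x /\ x ord0 i = t%:R.
  move=> Ex; have := Ex i; rewrite /set_coord eqxx => Exi.
  split=> [j|]; last lra.
  by have := Ex j; rewrite /set_coord; case: eqP => [->|_ //] _; lra.
have bdE x : box_bdry (set_coord a i t) (set_coord b i t) x -> box_bdry a b x.
  move=> [Ex [j H]]; split; first by have [] := inE _ Ex.
  by move: H; rewrite /set_coord; case: eqP => [_|_ H]; [rewrite ltnn; case|exists j].
have EbdE x : E x -> box_bdry a b x ->
    box_bdry (set_coord a i t) (set_coord b i t) x.
  move=> Ex [_ [j [abj h]]]; split => //; exists j; rewrite /set_coord.
  case: eqP => // ji; move: h; rewrite ji (inE _ Ex).2 => -[] h; lra.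
have [g0 [cg0 Cg0 g0f]] := HE f (continuous_subspaceW bdE cf)
  (fun x h => Cf x (bdE x h)).
have [f' [cf' f'f f'g0]] : exists f', [/\
    {within box_bdry a b `|` E, continuous f'},
    forall x, box_bdry a b x -> f' x = f x & forall x, E x -> f' x = g0 x].
  apply: within_continuous_paste => //; first exact: closed_box_bdry.
    exact: closed_box.
  by move=> x h1 h2; rewrite g0f//; exact: EbdE.
have Cf' x : (box_bdry a b `|` E) x -> C x (f' x).
  by move=> [h|h]; [rewrite f'f//; exact: Cf | rewrite f'g0//; exact: Cg0].
have boxL x : box a (set_coord b i t) x -> box a b x.
  move=> h j; have := h j; rewrite /set_coord; case: eqP => // ->; lra.
have boxU x : box (set_coord a i t) b x -> box a b x.
  move=> h j; have := h j; rewrite /set_coord; case: eqP => // ->; lra.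
(* The boundary of each half consists of boundary points of the whole box and points of the slice,
   so [f'] prescribes all of it. *)
have bdL x : box_bdry a (set_coord b i t) x -> (box_bdry a b `|` E) x.
  move=> [Lx [j [abj h]]]; move: abj h; rewrite /set_coord.
  case: eqP => [->|/eqP ji] abj h; last by left; split; [exact: boxL|exists j].
  case: h => h; first by left; split; [exact: boxL|exists i; split; [lia|left]].
  right => k; have := Lx k; rewrite /set_coord; case: eqP => // -> _.
  by rewrite h lexx.
have bdU x : box_bdry (set_coord a i t) b x -> (box_bdry a b `|` E) x.
  move=> [Lx [j [abj h]]]; move: abj h; rewrite /set_coord.
  case: eqP => [->|/eqP ji] abj h; last by left; split; [exact: boxU|exists j].
  case: h => h; last by left; split; [exact: boxU|exists i; split; [lia|right]].
  right => k; have := Lx k; rewrite /set_coord; case: eqP => // -> _.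
  by rewrite h lexx.
have [g1 [cg1 Cg1 g1f]] := HL f' (continuous_subspaceW bdL cf')
  (fun x h => Cf' x (bdL x h)).
have [g2 [cg2 Cg2 g2f]] := HU f' (continuous_subspaceW bdU cf')
  (fun x h => Cf' x (bdU x h)).
have LU x : box a (set_coord b i t) x -> box (set_coord a i t) b x -> E x.
  move=> h1 h2 j; have := h1 j; have := h2 j; rewrite /set_coord.
  by case: eqP => // ->; lra.
have [g [cg gg1 gg2]] : exists g, [/\
    {within box a (set_coord b i t) `|` box (set_coord a i t) b, continuous g},
    forall x, box a (set_coord b i t) x -> g x = g1 x &
    forall x, box (set_coord a i t) b x -> g x = g2 x].
  apply: within_continuous_paste => //; [exact: closed_box..|].
  move=> x xL xU; have Ex := LU _ xL xU.
  rewrite g1f ?g2f//; split=> //; exists i; rewrite /set_coord eqxx.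
    by split => //; left; case: (inE _ Ex).
  by split => //; right; case: (inE _ Ex).
have split_box x : box a b x ->
    box a (set_coord b i t) x \/ box (set_coord a i t) b x.
  move=> h; case: (leP (x ord0 i) t%:R) => ht; [left|right] => j; have := h j;
    rewrite /set_coord; case: eqP => // ->; lra.
exists g; split.
- by apply: continuous_subspaceW cg.
- by move=> x /split_box[h|h]; [rewrite gg1//; exact: Cg1|rewrite gg2//; exact: Cg2].
- move=> x bx; have [xab [j [abj h]]] := bx; rewrite -f'f//.
  have /split_box[xL|xU] := xab.
  + rewrite gg1// g1f//; split => //; exists j; rewrite /set_coord.
    case: eqP => // ji; subst j; split => //; left.
    by have := xL i; rewrite /set_coord eqxx; case: h => // ->; lra.
  + rewrite gg2// g2f//; split => //; exists j; rewrite /set_coord.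
    case: eqP => // ji; subst j; split => //; right.
    by have := xU i; rewrite /set_coord eqxx; case: h => // ->; lra.
Qed.

(** Induction on the total side length: cutting one unit off a side of length at least 2 lowers it
    for both halves and for the slice between them. What remains are cells, with all sides 0 or
    1. *)
Lemma box_extends_cells {T : topologicalType} (C : 'rV[R]_m -> set T) :
  (forall a b, (forall i, a i <= b i <= (a i).+1)%N -> box_extends C a b) ->
  forall a b, (forall i, a i <= b i)%N -> box_extends C a b.
Proof.
move=> cell a b; have [k] := ubnP (\sum_i (b i - a i))%N.
elim: k a b => // k IH a b; rewrite ltnS => hk ab.
have [/forallP h|/forallPn[i hi]] := boolP [forall i, b i <= (a i).+1]%N.
  by apply: cell => i; rewrite ab h.
have lt_sum a' b' : (forall j, b' j - a' j <= b j - a j)%N ->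
    (b' i - a' i < b i - a i)%N -> (\sum_j (b' j - a' j) < k)%N.
  move=> h1 h2; apply: leq_trans hk.
  rewrite (bigD1 i)//= [ltnRHS](bigD1 i)//=.
  by rewrite -addSn leq_add// leq_sum.
have abi := ab i.
apply: (@box_extends_split _ _ _ _ i (a i).+1); first lia.
all: apply: IH; [apply: lt_sum => [j|]|move=> j]; rewrite /set_coord ?eqxx.
all: try (have := ab j; case: eqP => [->|_]).
all: lia.
Qed.

End boxes.

(** * Conic complexes *)

Section complexes.
Variable n : nat.
Implicit Types (X L : {set {set 'I_n}}) (W s t : {set 'I_n}).

Lemma is_subcomplexP X : reflect (forall s, s \in X -> s != finset.set0 /\
  forall t, t != finset.set0 -> t \subset s -> t \in X) (is_subcomplex X).
Proof.
apply: (iffP forall_inP) => h s sX.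
  have /andP[s0 /forallP hs] := h s sX; split=> // t t0 ts.
  by apply: (implyP (hs t)); rewrite t0.
have [-> ht] := h s sX; apply/forallP => t.
by apply/implyP => /andP[]; exact: ht.
Qed.

(* The empty s is included, so that u itself is a vertex of X. *)
Definition coned_by L X (u : 'I_n) : bool :=
  [forall s in finset.set0 |: L, u |: s \in X]%SET.

(** The strict bound says that [L] has at most [M] faces when the empty one is counted; with this
    count the faces of a join multiply. *)
Definition conic M X : Prop := forall L, is_subcomplex L -> L \subset X ->
  (#|L| < M)%N -> exists u, coned_by L X u.

(** The intersection of the closed stars in [X] of the vertices in [W]. *)
Definition stars X W : {set {set 'I_n}} :=
  [set s in X | [forall w in W, w |: s \in X]]%SET.

Lemma is_subcomplex_stars X W : is_subcomplex X -> is_subcomplex (stars X W).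
Proof.
move=> /is_subcomplexP hX; apply/is_subcomplexP => s.
rewrite inE => /andP[/hX[s0 hs] /forall_inP hW]; split => // t t0 ts.
rewrite inE hs//=; apply/forall_inP => w /hW /hX[_]; apply.
  by apply/set0Pn; exists w; rewrite !inE eqxx.
exact: finset.setUS.
Qed.

Lemma subset_conic M M' X : (M' <= M)%N -> conic M X -> conic M' X.
Proof. by move=> MM h L L1 L2 L3; apply: h => //; exact: leq_trans MM. Qed.

(** Apply conicity of [X] to the join of [L] with the discrete set [W]. It lies in [X] because [L]
    lies in the stars, and it has at most [M * (#|W| + 1)] faces, the empty one included. Its cone
    point [u] also cones [L] inside the stars, since [w |: (u |: s) = u |: (w |: s)]. *)
Lemma conic_stars M X W : is_subcomplex X ->
  (forall w, w \in W -> [set w]%SET \in X) ->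
  conic (M * #|W|.+1) X -> conic M (stars X W).
Proof.
move=> /is_subcomplexP hX hW cX L hL LX cardL.
have hL' := is_subcomplexP _ hL.
pose ins (s : {set 'I_n}) (o : option 'I_n) := if o is Some w then w |: s else s.
pose ws : {set option 'I_n} := None |: Some @: W.
pose L0 : {set {set 'I_n}} := finset.set0 |: L.
have L0E v : (v \in L0) = (v == finset.set0) || (v \in L) by rewrite !inE.
(* L1 is the join of L with the discrete set W, empty face included. *)
pose L1 := [set ins s o | s in L0, o in ws]%SET.
pose L2 := (L1 :\ finset.set0)%SET.
have set0L : finset.set0 \notin L by apply/negP => /hL'[]; rewrite eqxx.
have L1P t : reflect (t \in L0 \/ exists2 w, w \in W & exists2 s, s \in L0 &
    t = w |: s) (t \in L1).
  apply: (iffP imset2P) => [[s o sL]|[tL|[w wW [s sL ->]]]].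
  - case: o => [w|] ow ->; last by left.
    right; exists w; last by exists s.
    by move: ow; rewrite !inE => /imsetP[w' ? [->]].
  - exists t None; [exact: tL|by rewrite !inE|by []].
  - by exists s (Some w); [exact: sL|rewrite !inE imset_f ?orbT|].
have L2X : L2 \subset X.
  apply/fintype.subsetP => t; rewrite in_setD1 => /andP[t0 /L1P[]].
    rewrite L0E (negPf t0)/= => /(fintype.subsetP LX).
    by rewrite inE => /andP[].
  move=> [w wW [s sL ->]]; move: sL.
  rewrite L0E => /orP[/eqP->|/(fintype.subsetP LX)].
    by rewrite finset.setU0 hW.
  by rewrite inE => /andP[_ /forall_inP/(_ w wW)].
have L2c : is_subcomplex L2.
  apply/is_subcomplexP => t; rewrite in_setD1 => /andP[t0 /L1P tL].
  split=> // u u0 ut; rewrite in_setD1 u0; apply/L1P.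
  case: tL => [|[w wW [s sL tE]]].
    rewrite L0E (negPf t0)/= => /hL'[_ h]; left.
    by rewrite L0E h ?orbT.
  have sub (v : {set 'I_n}) : v \subset s -> v \in L0.
    move=> vs; have [->|v0] := eqVneq v finset.set0; first by rewrite L0E eqxx.
    move: sL; rewrite !L0E => /orP[/eqP s0|/hL'[_ ->//]]; last by rewrite orbT.
    by move: vs; rewrite s0 finset.subset0 (negPf v0).
  have [wu|wu] := boolP (w \in u); last first.
    left; apply: sub; apply/fintype.subsetP => z zu.
    move/fintype.subsetP: ut => /(_ z zu); rewrite tE !inE => /orP[/eqP zw|//].
    by rewrite -zw zu in wu.
  right; exists w => //; exists (u :\ w)%SET; last by rewrite finset.setD1K.
  apply: sub; apply/fintype.subsetP => z; rewrite !inE => /andP[zw zu].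
  by move/fintype.subsetP: ut => /(_ z zu); rewrite tE !inE (negPf zw).
have L2M : (#|L2| < M * #|W|.+1)%N.
  have <- : #|L1| = #|L2|.+1.
    rewrite (cardsD1 finset.set0) (_ : _ \in L1)// ; apply/L1P.
    by left; rewrite L0E eqxx.
  rewrite /L1 curry_imset2X (leq_trans (leq_imset_card _ _))// cardsX leq_mul//.
    by rewrite cardsU1 set0L.
  rewrite cardsU1 card_imset; last by move=> ? ? [].
  by case: (_ \in _) => //=; rewrite leq_addl.
have [u /forall_inP hu] := cX _ L2c L2X L2M.
have inX t : t \in L1 -> u |: t \in X.
  move=> tL; apply: hu; rewrite !inE tL andbT; exact: orbN.
exists u; apply/forall_inP => s sL.
rewrite inE inX/=; last by apply/L1P; left.
apply/forall_inP => w wW; rewrite finset.setUCA inX//.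
by apply/L1P; right; exists w => //; exists s.
Qed.

Lemma conic_vertex M X : (0 < M)%N -> conic M X -> exists u, [set u]%SET \in X.
Proof.
move=> M0 /(_ finset.set0 (is_subcomplex0 n)); rewrite finset.sub0set cards0.
move=> /(_ isT M0)[u /forall_inP/(_ finset.set0)]; rewrite !inE eqxx.
by rewrite finset.setU0 => /(_ isT); exists u.
Qed.

End complexes.

(** * Extending maps from the boundary of a cube *)

Section sup_norm.
Variables (R : realType) (m : nat).
Implicit Types x : 'rV[R]_m.

Lemma rV_norm_leP x (c : R) : 0 <= c ->
  reflect (forall i, `|x ord0 i| <= c) (`|x| <= c).
Proof.
move=> c0; rewrite (_ : `|x| = mx_norm x)// mx_normrE; apply: (iffP idP) => [/bigmax_leP[_ h] i|h].
  exact: (h (ord0, i)).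
by apply/bigmax_leP; split => // -[i j] _ /=; rewrite ord1.
Qed.

Lemma rV_coord_le_norm x i : `|x ord0 i| <= `|x|.
Proof. by have /rV_norm_leP : `|x| <= `|x| by []; apply. Qed.

Lemma rV_norm_attained x : `|x| != 0 -> exists i, `|x ord0 i| = `|x|.
Proof. by move=> /mx_norm_neq0[[i j]/= h]; exists j; move: h; rewrite ord1 => <-. Qed.

Lemma closed_norm_itv (c d : R) : closed [set x : 'rV[R]_m | c <= `|x| <= d].
Proof.
rewrite (_ : mkset _ = (fun x : 'rV[R]_m => `|x|) @^-1` `[c, d]%classic); last first.
  by apply/seteqP; split => x /=; rewrite in_itv.
apply: closed_comp => [x _|]; first exact: norm_continuous.
exact: interval_closed.
Qed.

(** The norm of a row vector is the sup norm, so this concerns the boundary of the cube [[-1, 1]^m].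
    For [m = 0] the sphere is empty and a point of [A] is asked for, which is what 0-dimensional
    cells need. *)
Definition ext_sphere {T : topologicalType} (A : set T) : Prop :=
  forall f : 'rV[R]_m -> T, {within [set x : 'rV[R]_m | `|x| = 1], continuous f} ->
  (forall x, `|x| = 1 -> A (f x)) ->
  exists g : 'rV[R]_m -> T, [/\ {within [set x : 'rV[R]_m | `|x| <= 1], continuous g},
    forall x, `|x| <= 1 -> A (g x) & forall x, `|x| = 1 -> g x = f x].

(** The extension is constantly [e] on the ball of radius 1/2 and moves linearly along rays from [e]
    to the boundary value on the outer shell. The constant core keeps [x / |x|] away from the
    origin. *)
Lemma ext_sphere_star_shaped {V : normedModType R} (A : set V) (e : V) :
  A e -> (forall y t, A y -> 0 <= t <= 1 -> A ((1 - t) *: e + t *: y)) ->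
  ext_sphere A.
Proof.
move=> Ae Ac f cf Af.
pose S : set 'rV[R]_m := [set x | 0 <= `|x| <= 2^-1].
pose B : set 'rV[R]_m := [set x | 2^-1 <= `|x| <= 1].
have B0 x : B x -> `|x| != 0 by rewrite /B/= => h; apply/eqP; lra.
pose h x := (2 + -2 * `|x|) *: e + (-1 + 2 * `|x|) *: f (`|x|^-1 *: x).
have normE x : B x -> `|(`|x|^-1 *: x)| = 1.
  by move=> Bx; rewrite normrZ normfV normr_id mulVf// B0.
have ch : {within B, continuous h}.
  have c1 : {within B, continuous (fun x => f (`|x|^-1 *: x))}.
    apply: (within_continuous_comp_sub (B := [set x : 'rV[R]_m | `|x| = 1])) cf _ => //.
    apply: continuous_in_subspaceT => x /set_mem Bx.
    apply: (@continuousZ R _ _ (fun y : 'rV[R]_m => `|y|^-1) id x) => //.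
    apply: (@continuousV R _ (fun y : 'rV[R]_m => `|y|) x); first exact: B0.
    exact: norm_continuous.
  have c2 (k l : R) : {within B, continuous (fun x => k + l * `|x|)}.
    apply: continuous_subspaceT => x.
    apply: (@continuousD R R^o _ (cst k) (fun y : 'rV[R]_m => l * `|y|) x).
      exact: cst_continuous.
    apply: (@continuousM R _ (cst l) (fun y : 'rV[R]_m => `|y|) x).
      exact: cst_continuous.
    exact: norm_continuous.
  move=> x; apply: cvgD; apply: cvgZ; [|exact: cvg_cst| |exact: c1].
    exact: (c2 2 (-2) x).
  exact: (c2 (-1) 2 x).
have [g [cg gS gB]] : exists g, [/\ {within S `|` B, continuous g},
    forall x, S x -> g x = e & forall x, B x -> g x = h x].
  apply: within_continuous_paste => //; [exact: closed_norm_itv..| |].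
    by apply: continuous_subspaceT; exact: cst_continuous.
  move=> x; rewrite /S /B/= => Sx Bx; have xE : `|x| = 2^-1 by lra.
  rewrite /h xE (_ : -1 + 2 * 2^-1 = 0) ?scale0r ?addr0; last lra.
  by rewrite (_ : 2 + _ = 1) ?scale1r//; lra.
have SB (x : 'rV[R]_m) : `|x| <= 1 -> S x \/ B x.
  by move=> x1; have := normr_ge0 x; rewrite /S /B/= => x0;
    have [|/ltW] := leP `|x| 2^-1; [left|right]; lra.
exists g; split.
- exact: continuous_subspaceW SB cg.
- move=> x /SB[Sx|Bx]; first by rewrite gS.
  rewrite gB// /h (_ : 2 + -2 * `|x| = 1 - (-1 + 2 * `|x|)); last by lra.
  by apply: Ac; [apply: Af; exact: normE|move: Bx; rewrite /B/=; lra].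
- move=> x x1; have Bx : B x by rewrite /B/= x1; lra.
  rewrite gB// /h x1 invr1 scale1r !mulr1 subrr scale0r add0r.
  by rewrite (_ : -1 + 2 = 1) ?scale1r//; lra.
Qed.

End sup_norm.

Arguments ext_sphere R m {T} A.

(** Rescaling the non-degenerate directions identifies the cell with [[-1, 1]^#|S|]; as [box_bdry]
    ignores the degenerate directions, it corresponds to the unit sphere of the sup norm. *)
Lemma box_extends_cell {R : realType} m (T : topologicalType) (A : set T)
    (a b : 'I_m -> nat) :
  (forall i, a i <= b i <= (a i).+1)%N ->
  ext_sphere R #|[set i | (a i < b i)%N]%SET| A ->
  @box_extends R m T (fun=> A) a b.
Proof.
move=> ab; set S := [set i | _]%SET => hS f cf Af.
have inS i : (i \in S) = (a i < b i)%N by rewrite inE.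
have bE i : i \in S -> (b i)%:R = (a i)%:R + 1 :> R.
  rewrite inS => abi; have -> : b i = (a i).+1 by have := ab i; lia.
  by rewrite -natr1.
have bN i : i \notin S -> b i = a i by rewrite inS; have := ab i; lia.
pose coord (y : 'rV[R]_#|S|) i : R := match pselect (i \in S) with
  | left iS => 2^-1 * y ord0 (enum_rank_in iS i) + ((a i)%:R + 2^-1)
  | right _ => (a i)%:R end.
have coordS y k : coord y (enum_val k) =
    2^-1 * y ord0 k + ((a (enum_val k))%:R + 2^-1).
  by rewrite /coord; case: pselect => [p|]; [rewrite enum_valK_in|rewrite enum_valP].
have coordN y i : i \notin S -> coord y i = (a i)%:R.
  by move=> iS; rewrite /coord; case: pselect => // p; rewrite p in iS.
have caseS i : i \in S -> exists k : 'I_#|S|, i = enum_val k.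
  by move=> iS; exists (enum_rank_in iS i); rewrite enum_rankK_in.
pose emb y := \row_i coord y i.
pose prj (x : 'rV[R]_m) := \row_(k < #|S|) (2 * x ord0 (enum_val k) + (- (2 * (a (enum_val k))%:R + 1))).
have cemb : continuous emb.
  apply/continuous_subspace_setT; apply: within_continuous_rV => i.
  apply: continuous_subspaceT; rewrite (_ : (fun _ => _) = coord ^~ i).
    rewrite /coord; case: pselect => [p|_]; first exact: continuous_coord_affine.
    exact: cst_continuous.
  by apply/funext => y; rewrite mxE.
have cprj : continuous prj by exact: continuous_rV_affine.
have prjK x : box a b x -> emb (prj x) = x.
  move=> xab; apply/rowP => i; rewrite mxE.
  have [/caseS[k ->]|iS] := boolP (i \in S); first by rewrite coordS mxE; lra.
  by rewrite coordN//; have := xab i; rewrite bN// => h; lra.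
have prj_box x : box a b x -> `|prj x| <= 1.
  move=> xab; apply/rV_norm_leP => // k; rewrite mxE.
  by have := xab (enum_val k); rewrite (bE _ (enum_valP k)) ler_norml; lra.
have prj_bdry x : box_bdry a b x -> `|prj x| = 1.
  move=> [xab [i [abi h]]]; apply/eqP; rewrite eq_le prj_box//=.
  have /caseS[k ik] : i \in S by rewrite inS.
  apply: le_trans (rV_coord_le_norm _ k); rewrite mxE -ik.
  case: h => ->; first by rewrite (_ : _ + _ = -1) ?normrN ?normr1//; lra.
  by rewrite bE ?inS// (_ : _ + _ = 1) ?normr1//; lra.
have emb_bdry y : `|y| = 1 -> box_bdry a b (emb y).
  move=> y1; split=> [i|].
    rewrite mxE; have [/caseS[k ->]|iS] := boolP (i \in S).
      rewrite coordS (bE _ (enum_valP k)).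
      by have := rV_coord_le_norm y k; rewrite y1 ler_norml; lra.
    by rewrite coordN// bN// lexx.
  have [|k hk] := @rV_norm_attained _ _ y; first by rewrite y1 oner_neq0.
  exists (enum_val k); rewrite -inS enum_valP mxE coordS; split => //.
  have /eqP := hk; rewrite y1 eqr_norml ler01 andbT bE ?enum_valP//.
  by move=> /orP[]/eqP->; [right|left]; lra.
have [g [cg Ag gf]] := hS (f \o emb)
  (within_continuous_comp_sub (continuous_subspaceT cemb) cf emb_bdry)
  (fun y hy => Af _ (emb_bdry _ hy)).
exists (g \o prj); split.
- exact: within_continuous_comp_sub (continuous_subspaceT cprj) cg prj_box.
- by move=> x xab; exact/Ag/prj_box.
- by move=> x xab; rewrite /= gf ?prj_bdry//= prjK//; case: xab.
Qed.

(** * Realisations of complexes and of stars *)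

Section bodies.
Variables (R : realType) (n : nat).
Implicit Types (X : {set {set 'I_n}}) (x y : 'rV[R]_n).

Definition supp x : {set 'I_n} := [set i | x ord0 i != 0]%SET.

(** Same set as [realization], but for a bare family of sets, so that it applies to [stars X W]. *)
Definition body X : set 'rV[R]_n :=
  [set x : 'rV[R]_n | [/\ forall i, 0 <= x ord0 i, \sum_i x ord0 i = 1 & supp x \in X]].

Lemma supp_neq0 x : \sum_i x ord0 i = 1 -> supp x != finset.set0.
Proof.
move=> x1; apply/eqP => s0; have := oner_neq0 R; rewrite -x1 big1 ?eqxx// => i _.
by apply/eqP; move/setP/(_ i): s0; rewrite !inE => /negbFE.
Qed.

(** The coordinates average to [1 / n]. The bound does not depend on [x], which is what lets one
    mesh serve the whole grid in [conic_ext_sphere]. *)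
Lemma body_coord_ge X x : body X x -> exists i, n%:R^-1 <= x ord0 i.
Proof.
move=> [_ x1 _]; apply/not_existsP => h.
have n0 : (0 < n)%N.
  by have /set0Pn[i _] := supp_neq0 x1; exact: leq_trans (ltn_ord i).
suff : \sum_i x ord0 i < \sum_(i < n) n%:R^-1.
  by rewrite x1 sumr_const card_ord -[_ *+ n]mulr_natl mulfV ?ltxx// pnatr_eq0 -lt0n.
apply: ltr_sum => [|i _]; last by rewrite ltNge; apply/negP/h.
by apply/hasP; exists (Ordinal n0).
Qed.

Lemma body_starsP X W x :
  body (stars X W) x <-> body X x /\ forall w, w \in W -> w |: supp x \in X.
Proof.
split=> [[x0 x1]|[[x0 x1 sX] h]].
  by rewrite inE => /andP[sX /forall_inP h].
by split => //; rewrite inE sX; apply/forall_inP.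
Qed.

(** The segment from [y] to [v] stays in the simplex [v |: supp y], which belongs to [X] because [y]
    is in the star of [v]. *)
Lemma body_star_shaped X (v : 'I_n) y (t : R) : is_subcomplex X ->
  body (stars X [set v]) y -> 0 <= t <= 1 ->
  body (stars X [set v]) ((1 - t) *: \row_i (i == v)%:R + t *: y).
Proof.
move=> /is_subcomplexP hX /body_starsP[[y0 y1 sX] /(_ v)].
rewrite finset.in_set1 eqxx => /(_ isT) vX t01.
set z := _ + _; have zE i : z ord0 i = (1 - t) * (i == v)%:R + t * y ord0 i.
  by rewrite !mxE.
have z0 i : 0 <= z ord0 i.
  by rewrite zE addr_ge0// mulr_ge0 ?ler0n ?y0//; lra.
have z1 : \sum_i z ord0 i = 1.
  under eq_bigr do rewrite zE.
  rewrite big_split -!mulr_sumr/= y1 (bigD1 v)//= eqxx big1.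
    by rewrite addr0 !mulr1 subrK.
  by move=> i /negPf->.
have sz : supp z \subset v |: supp y.
  apply/fintype.subsetP => i; rewrite !inE zE; case: (eqVneq i v) => //= _.
  by apply: contraNN => /eqP ->; rewrite !mulr0 addr0.
have hz := (hX _ vX).2.
apply/body_starsP; split; first by split => //; apply: hz => //; exact: supp_neq0.
move=> w /set1P ->; apply: hz; first by apply/set0Pn; exists v; rewrite !inE eqxx.
by rewrite finset.subUset finset.sub1set !inE eqxx.
Qed.

Lemma body_vertex X (v : 'I_n) : [set v]%SET \in X ->
  body (stars X [set v]) (\row_i (i == v)%:R).
Proof.
move=> vX; have sE : supp (\row_i (i == v)%:R) = [set v]%SET.
  by apply/setP => i; rewrite !inE mxE pnatr_eq0 eqb0 negbK.
apply/body_starsP; split; last by move=> w /set1P ->; rewrite sE finset.setUid.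
split; last by rewrite sE.
  by move=> i; rewrite mxE.
by rewrite (bigD1 v)//= mxE eqxx big1 ?addr0// => i /negPf iv; rewrite mxE iv.
Qed.

Lemma ext_sphere_star m X (v : 'I_n) : is_subcomplex X -> [set v]%SET \in X ->
  ext_sphere R m (body (stars X [set v])).
Proof.
move=> hX vX; apply: ext_sphere_star_shaped; first exact: body_vertex vX.
by move=> y t; exact: body_star_shaped.
Qed.

End bodies.

Arguments body R {n} X.

(** * Extension over a labelled grid, cell by cell *)

Section conic_ext.
Variables (R : realType) (n m : nat) (X : {set {set 'I_n}}).
Hypothesis hX : is_subcomplex X.
Hypothesis IH : forall j (Y : {set {set 'I_n}}), (j < m)%N ->
  is_subcomplex Y -> conic (3 ^ j) Y -> ext_sphere R j (body R Y).
Hypothesis cX : conic (3 ^ m) X.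

Definition grid_cube (Q : 'I_m -> nat) : set 'rV[R]_m :=
  box Q (fun i => (Q i).+1).

(** The grid cubes around a cell arise by lowering some of its degenerate coordinates by one, so
    there are at most [2^k] of them in codimension [k]. A point of the cell off its boundary lies in
    no other grid cube, so there the requirement on the extension is exactly to land in [stars X W],
    with [W] the set of their labels. *)
Lemma label_extends (v : ('I_m -> nat) -> 'I_n)
    (hv : forall Q, [set v Q]%SET \in X) (a b : 'I_m -> nat) :
  (forall i, a i <= b i)%N ->
  box_extends (fun x y => forall Q, grid_cube Q x ->
    body R (stars X [set v Q]) y) a b.
Proof.
move: a b; apply: box_extends_cells => a b ab f cf Cf.
pose S := [set i | (a i < b i)%N]%SET.
(* The grid cubes containing the cell. *)
pose cub (T : {set 'I_m}) i := (a i - (i \in T))%N.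
pose W : {set 'I_n} := [set v (cub T) | T in powerset (~: S)]%SET.
have aS i : (i \in S) = (a i < b i)%N by rewrite inE.
have cub_bdry x (T : {set 'I_m}) : box a b x -> T \subset ~: S -> grid_cube (cub T) x.
  move=> xab /fintype.subsetP TS i; have := xab i; rewrite /cub.
  have [iT|_] := boolP (i \in T).
    have := TS _ iT; rewrite inE aS => h; have -> : b i = a i by have := ab i; lia.
    move=> /andP[h1 h2]; apply/andP; split.
      by apply: le_trans h1; rewrite ler_nat leq_subr.
    by apply: le_trans h2 _; rewrite ler_nat; lia.
  rewrite subn0 => /andP[-> h]; apply: le_trans h _.
  by rewrite ler_nat; have := ab i; lia.
have cub_in x Q : box a b x -> ~ box_bdry a b x -> grid_cube Q x ->
    exists2 T : {set 'I_m}, T \subset ~: S & Q = cub T.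
  move=> xab xbd Qx.
  have Qa i : (a i < b i)%N -> Q i = a i.
    move=> abi; have bi : b i = (a i).+1 by have := ab i; lia.
    have := Qx i; have := xab i => /andP[h1 h2] /andP[h3 h4].
    have h5 : (a i)%:R < x ord0 i.
      rewrite lt_neqAle h1 andbT; apply/eqP => e.
      by apply: xbd; split => //; exists i; split => //; left.
    have h6 : x ord0 i < (b i)%:R.
      rewrite lt_neqAle h2 andbT; apply/eqP => e.
      by apply: xbd; split => //; exists i; split => //; right.
    have := le_lt_trans h3 h6; have := lt_le_trans h5 h4.
    by rewrite !ltr_nat bi; lia.
  exists [set i | Q i != a i]%SET.
    by apply/fintype.subsetP => i; rewrite !inE; apply: contraNN => /Qa ->.
  apply/funext => i; rewrite /cub inE.
  have [->|Qai] := eqVneq (Q i) (a i); first by rewrite subn0.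
  have [/Qa Qai'|abi] := boolP (a i < b i)%N; first by rewrite Qai' eqxx in Qai.
  have bi : b i = a i by have := ab i; lia.
  have := Qx i; have := xab i; rewrite bi -eq_le => /eqP <-.
  rewrite !ler_nat => /andP[]; lia.
have fY x : box_bdry a b x -> body R (stars X W) (f x).
  move=> xbd; have hf (T : {set 'I_m}) : T \subset ~: S -> body R (stars X [set v (cub T)]) (f x).
    by move=> TS; apply: Cf => //; apply: cub_bdry => //; case: xbd.
  apply/body_starsP; split.
    by have /body_starsP[] := hf _ (finset.sub0set _).
  move=> w /imsetP[T]; rewrite powersetE => TS ->.
  by have /body_starsP[_] := hf _ TS; apply; rewrite inE.
have extY : ext_sphere R #|S| (body R (stars X W)).
  (* In codimension 0 there is a single cube, so the target is the star of one vertex. Otherwise the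
     cell has dimension [#|S| < m] and induction applies to [stars X W]. *)
  have [ST|SnT] := eqVneq S [set: 'I_m]%SET.
    have -> : W = [set v (cub finset.set0)]%SET.
      by rewrite /W ST finset.setCT powerset0 imset_set1.
    exact: ext_sphere_star.
  have Sm : (#|S| + #|~: S| = m)%N by rewrite cardsC card_ord.
  have S0 : (0 < #|~: S|)%N.
    by rewrite card_gt0; apply: contraNN SnT => /eqP h; rewrite -[S]finset.setCK h finset.setC0.
  apply: IH; [lia|exact: is_subcomplex_stars|].
  apply: conic_stars => //; first by move=> w /imsetP[T _ ->].
  apply: subset_conic cX.
  rewrite (_ : (3 ^ m = 3 ^ #|S| * 3 ^ #|~: S|)%N); last by rewrite -expnD Sm.
  rewrite leq_mul2l; apply/orP; right.
  (* [2^k + 1 <= 3^k] needs [k > 0], hence the separate treatment of codimension 0. *)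
  apply: (@leq_trans (2 ^ #|~: S|).+1); last by rewrite ltn_exp2r.
  rewrite ltnS -card_powerset.
  exact: leq_imset_card.
have [g [cg Cg gf]] := box_extends_cell ab extY cf fY.
exists g; split => // x xab Q Qx.
have [xbd|xbd] := pselect (box_bdry a b x); first by rewrite gf//; exact: Cf.
have [T TS ->] := cub_in _ _ xab xbd Qx.
have /body_starsP[h1 h2] := Cg _ xab; apply/body_starsP; split => // w /set1P ->.
by apply: h2; apply: imset_f; rewrite powersetE.
Qed.

End conic_ext.

(** It remains to label the grid. The cube is rescaled to [[0, N]^m], with [N] so large that unit
    grid cubes correspond to cubes of side [2 / N < d], on which [f] varies by less than [1 / n]. *)
Lemma conic_ext_sphere (R : realType) n m (X : {set {set 'I_n}}) :
  is_subcomplex X -> conic (3 ^ m) X -> ext_sphere R m (body R X).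
Proof.
elim/ltn_ind: m X => m IH X hX cX f cf Af.
have [v0 v0X] : exists v, [set v]%SET \in X.
  by apply: conic_vertex cX; rewrite expn_gt0.
have n0 : (0 < n)%N := leq_trans (ltn0Sn _) (ltn_ord v0).
have S_compact : compact [set x : 'rV[R]_m | `|x| = 1].
  apply: bounded_closed_compact.
    by exists 1; split; [exact: num_real|move=> r /ltW r1 x /= ->].
  have := @closed_norm_itv R m 1 1; congr closed.
  apply/seteqP; split => x /=; rewrite -eq_le; first by move/eqP.
  by move=> ->.
have [d d0 hd] : exists2 d, 0 < d & forall x y : 'rV[R]_m, `|x| = 1 ->
    `|y| = 1 -> `|x - y| < d -> `|f x - f y| < n%:R^-1.
  by apply: compact_uniform_continuity S_compact cf _; rewrite invr_gt0 ltr0n.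
pose N := Num.bound (2 / d).
have hN : 2 / d < N%:R by apply: archi_boundP; rewrite ltW// divr_gt0.
have NR0 : 0 < N%:R :> R by rewrite (lt_trans _ hN)// divr_gt0.
have N0 : (0 < N)%N by move: NR0; rewrite ltr0n.
have Nd : 2 / N%:R < d by rewrite ltr_pdivrMr// mulrC -ltr_pdivrMr.
pose zero (i : 'I_m) := 0%N; pose top (i : 'I_m) := N.
pose phi (y : 'rV[R]_m) := \row_i (2 / N%:R * y ord0 i + (-1)).
pose psi (x : 'rV[R]_m) := \row_i (N%:R / 2 * x ord0 i + N%:R / 2).
have cphi : continuous phi.
  exact: (@continuous_rV_affine R m m id (fun=> 2 / N%:R) (fun=> -1)).
have cpsi : continuous psi.
  exact: (@continuous_rV_affine R m m id (fun=> N%:R / 2) (fun=> N%:R / 2)).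
have psiK x : phi (psi x) = x.
  by apply/rowP => i; rewrite !mxE; field; rewrite gt_eqF.
have phi_box y : box zero top y -> `|phi y| <= 1.
  move=> hy; apply/rV_norm_leP => // i; rewrite mxE ler_norml.
  have /andP[y0 yN] := hy i.
  have : 0 <= 2 / N%:R * y ord0 i by rewrite mulr_ge0// divr_ge0// ltW.
  have : 2 / N%:R * y ord0 i <= 2.
    by rewrite mulrAC ler_pdivrMr// ler_pM2l.
  lra.
have phi_bdry y : box_bdry zero top y -> `|phi y| = 1.
  move=> [hy [i [_ hi]]]; apply/eqP; rewrite eq_le phi_box//=.
  apply: le_trans (rV_coord_le_norm _ i); rewrite mxE.
  case: hi => ->; first by rewrite mulr0 add0r normrN normr1.
  rewrite divfK ?gt_eqF// (_ : 2 + -1 = 1) ?normr1//; lra.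
have psi_box x : `|x| <= 1 -> box zero top (psi x).
  move=> hx i; rewrite mxE /zero /top.
  have /andP[x0 x1] : -1 <= x ord0 i <= 1.
    by rewrite -ler_norml (le_trans (rV_coord_le_norm _ _)).
  have -> : N%:R / 2 * x ord0 i + N%:R / 2 = N%:R * ((x ord0 i + 1) / 2) by lra.
  by rewrite mulr_ge0 ?ler_piMr//; lra.
have psi_bdry x : `|x| = 1 -> box_bdry zero top (psi x).
  move=> hx; split; first by apply: psi_box; rewrite hx.
  have [|k hk] := @rV_norm_attained _ _ x; first by rewrite hx oner_neq0.
  exists k; split => //; rewrite mxE /zero /top.
  have /eqP := hk; rewrite hx eqr_norml ler01 andbT.
  by move=> /orP[]/eqP->; [right|left]; lra.
have label (Q : 'I_m -> nat) : exists v, [set v]%SET \in X /\ forall y,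
    box_bdry zero top y -> grid_cube Q y -> body R (stars X [set v]) (f (phi y)).
  have [[y0 [y0b y0Q]]|none] :=
      pselect (exists y0, box_bdry zero top y0 /\ @grid_cube R m Q y0); last first.
    (* A cube that misses the boundary carries no constraint, so any vertex can label it. *)
    by exists v0; split => // y yb yQ; exfalso; apply: none; exists y.
  (* f moves by less than 1/n on Q, so a coordinate that is at least 1/n at *)
  (* one point stays positive on all of Q.                                  *)
  have [v hv] := body_coord_ge (Af _ (phi_bdry _ y0b)).
  have near y : box_bdry zero top y -> grid_cube Q y -> f (phi y) ord0 v != 0.
    move=> yb yQ; have lt : `|f (phi y0) - f (phi y)| < n%:R^-1.
      apply: hd; [exact: phi_bdry..|].
      rewrite (le_lt_trans _ Nd)//; apply/rV_norm_leP => [|i].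
        by rewrite divr_ge0// ltW.
      rewrite !mxE (_ : _ - _ = 2 / N%:R * (y0 ord0 i - y ord0 i)); last by ring.
      rewrite normrM gtr0_norm ?divr_gt0// ler_piMr//.
      have := y0Q i; have := yQ i; rewrite -natr1 ler_norml; lra.
    have := le_lt_trans (rV_coord_le_norm _ v) lt; rewrite !mxE.
    by apply: contraTneq => ->; rewrite subr0 -leNgt (le_trans hv)// ler_norm.
  have star y : box_bdry zero top y -> grid_cube Q y ->
      v |: supp (f (phi y)) \in X.
    move=> yb yQ; have [_ _ sX] := Af _ (phi_bdry _ yb).
    by rewrite (finset.setUidPr _)// finset.sub1set inE near.
  exists v; split=> [|y yb yQ].
    apply: ((is_subcomplexP _ hX _ (star _ y0b y0Q)).2).
      by apply/set0Pn; exists v; rewrite inE.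
    by rewrite finset.sub1set !inE eqxx.
  apply/body_starsP; split; first exact/Af/phi_bdry.
  by move=> w /set1P ->; exact: star.
have [v hv] := choice label.
have := @label_extends R n m X hX (fun j Y h => IH j h Y) cX v
  (fun Q => (hv Q).1) zero top (fun=> leq0n _).
case/(_ (f \o phi)).
- exact: within_continuous_comp_sub (continuous_subspaceT cphi) cf phi_bdry.
- by move=> y yb Q yQ; exact: (hv Q).2.
move=> g [cg Cg gf]; exists (g \o psi); split.
- exact: within_continuous_comp_sub (continuous_subspaceT cpsi) cg psi_box.
- move=> x x1; have xb := psi_box _ x1.
  (* The conclusion on [g] speaks only of grid cubes through the point; the cube at its integer
     parts is one. *)
  have [|gX _] := (body_starsP _ _ _).1
      (Cg _ xb (fun i => Num.truncn (psi x ord0 i)) _); last exact: gX.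
  move=> i; have /andP[h0 _] := xb i.
  by have /andP[-> /ltW] := truncn_itv h0.
- by move=> x x1; rewrite /= gf; [rewrite /= psiK|exact: psi_bdry].
Qed.

(** * From the cube to the Euclidean disk *)

(** Radial projection [u] carries the boundary of the cube to the Euclidean sphere, where [f] is
    given. [conic 1] supplies the non-emptiness that is demanded even for [r < 0]. *)
Lemma conic_complex_connected (R : realType) n (r : int) (X : subcomplex n) :
  conic 1 X -> (forall d : nat, d%:Z <= r -> conic (3 ^ d.+1) X) ->
  complex_connected R r X.
Proof.
move=> c1 cX; split.
  have [v vX] := conic_vertex (ltn0Sn 0) c1.
  exists (\row_i (i == v)%:R).
  by have /body_starsP[] := body_vertex R vX.
move=> d f dr cf Af.
have hext : ext_sphere R d.+1 (body R X).
  by apply: conic_ext_sphere; [exact: simplexesP|exact: cX].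
pose nrm (x : 'rV[R]_d.+1) := \sum_i x ord0 i ^+ 2.
have nrmZ k (x : 'rV[R]_d.+1) : nrm (k *: x) = k ^+ 2 * nrm x.
  by rewrite /nrm mulr_sumr; apply: eq_bigr => i _; rewrite mxE exprMn.
have nrm_le (x : 'rV[R]_d.+1) i : x ord0 i ^+ 2 <= nrm x.
  by rewrite /nrm (bigD1 i)//= lerDl sumr_ge0// => j _; rewrite sqr_ge0.
have nrm_gt0 (x : 'rV[R]_d.+1) : 0 < `|x| -> 0 < nrm x.
  move=> x0; have [|i hi] := @rV_norm_attained _ _ x; first by rewrite gt_eqF.
  by apply: lt_le_trans (nrm_le x i); rewrite -real_normK ?num_real// hi exprn_gt0.
have cnrm : continuous nrm.
  move=> x; rewrite /nrm; elim: (index_enum _) => [|i s IHs].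
    by under eq_fun do rewrite big_nil; exact: cst_continuous.
  under eq_fun do rewrite big_cons.
  apply: (@continuousD R R^o _ (fun y : 'rV[R]_d.+1 => y ord0 i ^+ 2)
    (fun y => \sum_(j <- s) y ord0 j ^+ 2) x) => //.
  apply: (@continuousM R _ (fun y : 'rV[R]_d.+1 => y ord0 i) (fun y => y ord0 i) x).
    exact: coord_continuous.
  exact: coord_continuous.
pose u (x : 'rV[R]_d.+1) := (Num.sqrt (nrm x))^-1 *: x.
have u_sphere x : 0 < `|x| -> sphere R d (u x).
  move=> /nrm_gt0 x0; rewrite /sphere/= -/(nrm _) nrmZ exprVn sqr_sqrtr ?ltW//.
  by rewrite mulVf// gt_eqF.
have uZ k x : 0 < k -> u (k *: x) = u x.
  move=> k0; rewrite /u nrmZ sqrtrM ?sqr_ge0// sqrtr_sqr gtr0_norm//.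
  rewrite invfM scalerA mulrAC; congr (_ *: _).
  by rewrite mulVf ?mul1r// gt_eqF.
have u_id x : sphere R d x -> u x = x.
  by rewrite /u /sphere/= => h; rewrite /nrm h sqrtr1 invr1 scale1r.
have cu (A : set 'rV[R]_d.+1) : (forall x, A x -> 0 < `|x|) ->
    {within A, continuous (f \o u)}.
  move=> A0; apply: (within_continuous_comp_sub (B := sphere R d)) cf _; last first.
    by move=> x /A0; exact: u_sphere.
  apply: continuous_in_subspaceT => x /set_mem /A0 /nrm_gt0 x0.
  apply: (@continuousZ R _ _ (fun y => (Num.sqrt (nrm y))^-1) id x) => //.
  apply: (@continuousV R _ (fun y => Num.sqrt (nrm y)) x).
    by rewrite gt_eqF// sqrtr_gt0.
  apply: (@continuous_comp _ _ _ nrm Num.sqrt x); first exact: cnrm.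
  exact: sqrt_continuous.
(* The cube of half-side c lies inside the disk; outside of it, f o u is an  *)
(* extension that is constant along rays.                                    *)
pose c : R := d.+1%:R^-1; have c0 : 0 < c by rewrite invr_gt0 ltr0n.
have [G [cG AG Gf]] := hext (f \o u) (cu [set x | `|x| = 1] (fun x h =>
  eq_ind_r (fun t => 0 < t) ltr01 h))
  (fun x h => Af _ (imageP f (u_sphere x (eq_ind_r (fun t => 0 < t) ltr01 h)))).
pose A := [set x : 'rV[R]_d.+1 | 0 <= `|x| <= c].
pose B := [set x : 'rV[R]_d.+1 | c <= `|x| <= d.+1%:R].
have B0 x : B x -> 0 < `|x| by move=> /andP[+ _]; exact: lt_le_trans.
have sA x : A x -> `|c^-1 *: x| <= 1.
  move=> /andP[_ xc].
  by rewrite normrZ normfV gtr0_norm// mulrC ler_pdivrMr// mul1r.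
have [g [cg gA gB]] : exists g, [/\ {within A `|` B, continuous g},
    forall x, A x -> g x = G (c^-1 *: x) & forall x, B x -> g x = f (u x)].
  apply: within_continuous_paste; [exact: closed_norm_itv..| | |].
  - apply: (@within_continuous_comp_sub _ _ _ A _ ( *:%R c^-1) G _ cG sA).
    by apply: continuous_subspaceT => x; exact: scaler_continuous.
  - exact: cu.
  - move=> x /andP[_ xc] /andP[cx _]; have xE : `|x| = c by apply/le_anti/andP.
    rewrite Gf/= ?uZ ?invr_gt0//.
    by rewrite normrZ normfV gtr0_norm// xE mulVf// gt_eqF.
have AB x : disk R d x -> A x \/ B x.
  move=> xd; have [xc|/ltW cx] := leP `|x| c; [left|right].
    by rewrite /A/= normr_ge0.
  rewrite /B/= cx/=; apply/rV_norm_leP => // i.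
  apply: (@le_trans _ _ 1); last by rewrite ler1n.
  rewrite -(@expr_le1 _ 2)// real_normK ?num_real//.
  exact: le_trans (nrm_le x i) xd.
have SB x : sphere R d x -> B x.
  move=> xs; have xd : disk R d x by move: xs; rewrite /sphere /disk/= => ->.
  have [/andP[_ xc]|//] := AB x xd; rewrite /B/=; apply/andP; split; last first.
    by rewrite (le_trans xc)// (@le_trans _ _ 1)// ?ler1n// invf_le1 ?ltr0n// ler1n.
  (* If all coordinates were below [c <= 1] in absolute value, each square would be below [c], and
     their sum below [(d + 1) * c = 1]. *)
  rewrite leNgt; apply/negP => lt.
  suff : nrm x < 1 by rewrite /nrm xs ltxx.
  apply: (@lt_le_trans _ _ (\sum_(i < d.+1) c)); last first.
    by rewrite sumr_const card_ord -mulr_natl mulfV ?pnatr_eq0.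
  apply: ltr_sum => [|i _]; first by apply/hasP; exists ord0 => //; rewrite mem_index_enum.
  rewrite -real_normK ?num_real// expr2.
  have xi : `|x ord0 i| < c := le_lt_trans (rV_coord_le_norm _ _) lt.
  have cle1 : c <= 1 by rewrite invf_le1 ?ltr0n// ler1n.
  apply: le_lt_trans xi; rewrite ler_piMr//.
  by rewrite (le_trans (rV_coord_le_norm _ _))// (le_trans xc).
exists g; split.
- exact: continuous_subspaceW AB cg.
- move=> _ [x /AB[xA|xB] <-]; first by rewrite gA//; exact/AG/sA.
  by rewrite gB//; apply: Af; apply: imageP; exact/u_sphere/B0.
- by move=> x xs; rewrite gB ?u_id//; exact: SB.
Qed.

(** * Random complexes are conic *)

Section cones.
Variable n : nat.
Implicit Types (X K L : {set {set 'I_n}}).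

(** Only the faces through the apex, without the base [L]: for distinct apexes outside [L] these
    families are disjoint, whence independence. *)
Definition cone L (w : 'I_n) : {set {set 'I_n}} :=
  [set w |: s | s in finset.set0 |: L]%SET.

Lemma coned_byE L X w : coned_by L X w = (cone L w \subset X).
Proof.
apply/forall_inP/fintype.subsetP => [h _ /imsetP[s sL ->]|h s sL].
  exact: h.
by apply: h; apply: imset_f.
Qed.

Lemma card_cone L w : (#|cone L w| <= #|L|.+1)%N.
Proof.
rewrite (leq_trans (leq_imset_card _ _))// cardsU1.
by case: (_ \in _) => //=; rewrite leq_addl.
Qed.

Lemma cone_neq0 L w s : s \in cone L w -> s != finset.set0.
Proof.
by move=> /imsetP[t _ ->]; apply/set0Pn; exists w; rewrite !inE eqxx.
Qed.

Lemma is_subcomplexU_cone K L w : is_subcomplex K -> is_subcomplex L ->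
  L \subset K -> is_subcomplex (K :|: cone L w)%SET.
Proof.
move=> /is_subcomplexP hK /is_subcomplexP hL LK; apply/is_subcomplexP => s.
rewrite inE => /orP[/hK[s0 hs]|sc].
  by split=> // t t0 ts; rewrite inE hs.
split; first exact: cone_neq0 sc.
have /imsetP[u uL ->] := sc => t t0 tw; rewrite inE.
have subu (v : {set 'I_n}) : v \subset u -> v = finset.set0 \/ v \in L.
  move=> vu; have [->|v0] := eqVneq v finset.set0; [by left|right].
  move: uL; rewrite !inE => /orP[/eqP u0|/hL[_ ->//]].
  by move: vu; rewrite u0 finset.subset0 (negPf v0).
have [wt|wt] := boolP (w \in t).
  apply/orP; right; apply/imsetP; exists (t :\ w)%SET; last by rewrite finset.setD1K.
  rewrite !inE; case: (subu (t :\ w)%SET) => [|->|->]; rewrite ?eqxx ?orbT//.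
  by apply/fintype.subsetP => z; rewrite !inE => /andP[zw] /(fintype.subsetP tw);
    rewrite !inE (negPf zw).
have [|te|/(fintype.subsetP LK) ->//] := subu t; last by rewrite te eqxx in t0.
apply/fintype.subsetP => z zt; have := fintype.subsetP tw _ zt.
by rewrite !inE => /orP[/eqP zw|//]; rewrite -zw zt in wt.
Qed.

Lemma cone_disjoint K L w : is_subcomplex K -> [set w]%SET \notin K ->
  fintype.disjoint (mem K) (mem (cone L w)).
Proof.
move=> /is_subcomplexP hK; apply: contraNT => /pred0Pn[s /andP[/= sK]].
move=> /imsetP[t _ se]; apply: (hK _ sK).2; first by apply/set0Pn; exists w; rewrite inE.
by rewrite finset.sub1set se !inE eqxx.
Qed.

Lemma card_vertices_le K : (#|[set w | [set w]%SET \in K]%SET| <= #|K|)%N.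
Proof.
rewrite -(card_imset _ set1_inj).
by apply/subset_leq_card/fintype.subsetP => _ /imsetP[w + ->]; rewrite inE.
Qed.

Lemma card_simplex_le K s : is_subcomplex K -> s \in K -> (#|s| <= #|K|)%N.
Proof.
move=> /is_subcomplexP hK sK; apply: leq_trans (card_vertices_le K).
apply/subset_leq_card/fintype.subsetP => w ws; rewrite inE.
apply: (hK _ sK).2; last by rewrite finset.sub1set.
by apply/set0Pn; exists w; rewrite inE.
Qed.

End cones.

(** * Counting small subcomplexes *)

Section counting.

Lemma finset_enc (T : finType) M (A : {set T}) : (#|A| <= M)%N ->
  exists g : {ffun 'I_M -> option T}, [set x | [exists k, g k == Some x]]%SET = A.
Proof.
move=> AM; exists [ffun k : 'I_M => nth None (map Some (enum A)) k].
apply/setP => x; rewrite inE; apply/existsP/idP => [[k]|xA].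
  rewrite ffunE => /eqP h; have kA : (k < size (enum A))%N.
    rewrite ltnNge; apply/negP => Ak.
    by rewrite nth_default ?size_map in h.
  have x0 : T := x; rewrite (nth_map x) in h => //.
  by case: h => <-; rewrite -mem_enum mem_nth.
have iA : (index x (enum A) < size (enum A))%N by rewrite index_mem mem_enum.
have iM : (index x (enum A) < M)%N by apply: leq_trans AM; rewrite cardE.
by exists (Ordinal iM); rewrite ffunE/= (nth_map x)// nth_index// mem_enum.
Qed.

Lemma card_small_subcomplexes n M :
  (#|[set L : {set {set 'I_n}} | is_subcomplex L & #|L| < M]%SET| <=
   n.+1 ^ (M * M))%N.
Proof.
pose dec1 (g : {ffun 'I_M -> option 'I_n}) := [set x | [exists k, g k == Some x]]%SET.
pose dec (h : {ffun 'I_M -> {ffun 'I_M -> option 'I_n}}) : {set {set 'I_n}} :=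
  ([set dec1 (h k) | k : 'I_M] :\ finset.set0)%SET.
apply: (@leq_trans #|dec @: [set: {ffun 'I_M -> {ffun 'I_M -> option 'I_n}}]%SET|).
  apply/subset_leq_card/fintype.subsetP => L; rewrite inE => /andP[hL LM].
  have enc (s : {set 'I_n}) : exists g, (#|s| <= M)%N -> dec1 g = s.
    have [/finset_enc[g gs]|] := boolP (#|s| <= M)%N; first by exists g.
    by exists [ffun=> None].
  have [G hG] := choice enc.
  have hG' k : dec1 (G (nth finset.set0 (enum L) k)) = nth finset.set0 (enum L) k.
    apply: hG; have [kL|kL] := ltnP k (size (enum L)); last first.
      by rewrite nth_default// cards0.
    have : nth finset.set0 (enum L) k \in L by rewrite -mem_enum mem_nth.
    by move=> /(card_simplex_le hL)/leq_trans -> //; exact: ltnW.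
  apply/imsetP; exists [ffun k : 'I_M => G (nth finset.set0 (enum L) k)] => //.
  apply/setP => s; rewrite !inE; apply/idP/andP => [sL|[s0 /imsetP[k _]]].
    split; first by have [] := is_subcomplexP _ hL s sL.
    have iL : (index s (enum L) < size (enum L))%N by rewrite index_mem mem_enum.
    have iM : (index s (enum L) < M)%N by apply: ltn_trans LM; rewrite cardE.
    apply/imsetP; exists (Ordinal iM) => //.
    by rewrite ffunE hG' nth_index// mem_enum.
  rewrite ffunE hG' => se; move: s0; rewrite se.
  have [kL|kL] := ltnP k (size (enum L)); first by rewrite -mem_enum mem_nth.
  by rewrite nth_default// eqxx.
rewrite (leq_trans (leq_imset_card _ _))// cardsT !card_ffun card_option !card_ord.
by rewrite -expnM.
Qed.

End counting.

(** * Independence of cones and the union bound *)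

Section probability_bound.
Variables (R : realType) (n : nat) (par : {set 'I_n} -> R).
Variable P : probability (subcomplex n) R.
Hypothesis hP : lower_model par P.

Lemma subcomplex_measurable (A : set (subcomplex n)) : measurable A.
Proof. by []. Qed.

(* Independence of the events [cone L w \subset X], by inclusion-exclusion on *)
(* one vertex at a time: it uses nothing but the defining property of P.     *)
Lemma lower_model_no_cone (L K : {set {set 'I_n}}) (ws : seq 'I_n) :
  is_subcomplex L -> is_subcomplex K -> L \subset K ->
  uniq ws -> (forall w, w \in ws -> [set w]%SET \notin K) ->
  P [set X : subcomplex n | K \subset X /\ forall w, w \in ws ->
      ~~ (cone L w \subset X)] =
  ((\prod_(s in K) par s) * \prod_(w <- ws) (1 - \prod_(s in cone L w) par s))%:E.
Proof.
move=> hL; elim: ws K => [|w ws IH] K hK LK.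
  move=> _ _; rewrite big_nil mulr1 -(hP (Subcomplex hK)); congr (P _).
  by apply/seteqP; split => X /=; [case|].
move=> /= /andP[wws uws] hws.
have hK' := is_subcomplexU_cone w hK hL LK.
set A := [set X | _].
(* [B] drops the condition at [w] and [C] violates it, so [P A = P B - P C]. Both have the form of
   the induction hypothesis, [C] with [K] enlarged by the cone. *)
pose B := [set X : subcomplex n | K \subset X /\ forall w, w \in ws ->
      ~~ (cone L w \subset X)].
pose C := [set X : subcomplex n | (K :|: cone L w)%SET \subset X /\ forall w, w \in ws ->
      ~~ (cone L w \subset X)].
have PB : P B = ((\prod_(s in K) par s) *
    \prod_(w <- ws) (1 - \prod_(s in cone L w) par s))%:E.
  by apply: IH => // v vws; apply: hws; rewrite inE vws orbT.
have PC : P C = ((\prod_(s in (K :|: cone L w)%SET) par s) *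
    \prod_(w <- ws) (1 - \prod_(s in cone L w) par s))%:E.
  apply: IH => //; first by rewrite (fintype.subset_trans LK)// finset.subsetUl.
  move=> v vws; rewrite inE negb_or hws ?inE ?vws ?orbT//=.
  apply/negP => /imsetP[t _ /setP/(_ w)]; rewrite !inE eqxx/= => /eqP wv.
  by rewrite wv vws in wws.
have BAC : B = A `|` C.
  apply/seteqP; split => X /=.
    move=> [KX hX]; have [wX|wX] := boolP (cone L w \subset X); [right|left].
      by rewrite /C/= finset.subUset KX wX.
    by split => // v; rewrite inE => /predU1P[->//|/hX].
  move=> [[KX hX]|[]]; first by split => // v vws; apply: hX; rewrite inE vws orbT.
  by rewrite finset.subUset => /andP[KX _] hX.
have AC : A `&` C = set0.
  apply/seteqP; split => X //= [[_ /(_ w)]]; rewrite mem_head => /(_ isT) h1.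
  by rewrite /C/= finset.subUset (negPf h1) andbF => -[].
have : P B = (P A + P C)%E by rewrite BAC measureU.
have /fin_numP[] : P A \is a fin_num by exact: fin_num_measure.
case: (P A) => // r _ _; rewrite PB PC -EFinD => -[h]; congr EFin.
rewrite big_cons.
have -> : r = \prod_(s in K) par s * \prod_(w0 <- ws) (1 - \prod_(s in cone L w0) par s) -
    \prod_(s in (K :|: cone L w)%SET) par s * \prod_(w0 <- ws) (1 - \prod_(s in cone L w0) par s).
  by rewrite h addrK.
have -> : \prod_(s in (K :|: cone L w)%SET) par s =
    \prod_(s in K) par s * \prod_(s in cone L w) par s.
  rewrite -bigU/=; first by apply: eq_bigl => s; rewrite !inE.
  by apply: cone_disjoint => //; apply: hws; exact: mem_head.
by ring.
Qed.

Variable p : R.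
Hypotheses (p0 : 0 < p) (p1 : p < 1).
Hypothesis par_bounds : forall s, s != finset.set0 -> p <= par s <= 1.

(** Only apexes outside [L] are used: there are at least [n - M], their cones are independent given
    [L], and each cone has at most [#|L| + 1 <= M] faces of probability at least [p]. *)
Lemma lower_model_not_coned (L : {set {set 'I_n}}) M :
  is_subcomplex L -> (#|L| < M)%N ->
  (P [set X : subcomplex n | L \subset X /\ forall w, ~~ coned_by L X w] <=
    ((1 - p ^+ M) ^+ (n - M))%:E)%E.
Proof.
move=> hL LM; pose ws := enum [set w | [set w]%SET \notin L]%SET.
have hprod (A : {set {set 'I_n}}) : (forall s, s \in A -> s != finset.set0) ->
    p ^+ #|A| <= \prod_(s in A) par s <= 1.
  move=> A0; rewrite -prodr_const; apply/andP; split.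
    by apply: ler_prod => s /A0/par_bounds/andP[-> _]; rewrite ltW.
  apply: prodr_ile1 => s /A0/par_bounds/andP[ps ->]; rewrite andbT.
  by apply: le_trans ps; exact: ltW.
have pM01 : 0 <= 1 - p ^+ M <= 1.
  by rewrite subr_ge0 gerBl exprn_ge0 ?exprn_ile1// ltW.
apply: (@le_trans _ _ (P [set X : subcomplex n | L \subset X /\
    forall w, w \in ws -> ~~ (cone L w \subset X)])).
  apply: le_measure; rewrite ?inE//; try exact: subcomplex_measurable.
  by move=> X [LX h]; split => // w _; rewrite -coned_byE.
rewrite lower_model_no_cone ?enum_uniq//; last first.
  by move=> w; rewrite mem_enum inE.
rewrite lee_fin.
apply: (@le_trans _ _ (1 * \prod_(w <- ws) (1 - p ^+ M))).
  apply: ler_pM.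
  - apply: prodr_ge0 => s sL.
    have /par_bounds/andP[+ _] := (is_subcomplexP _ hL _ sL).1.
    by apply: le_trans; rewrite ltW.
  - apply: prodr_ge0 => w _; rewrite subr_ge0.
    by have /andP[] := hprod (cone L w) (fun s => @cone_neq0 _ L w s).
  - by have /andP[] := hprod L (fun s sL => (is_subcomplexP _ hL _ sL).1).
  - apply: ler_prod => w _.
    have /andP[h1 h2] := hprod (cone L w) (fun s => @cone_neq0 _ L w s).
    rewrite subr_ge0 h2 lerD2l lerN2; apply: le_trans h1.
    rewrite ler_wiXn2l ?ltW//.
    exact: leq_trans (card_cone _ _) LM.
rewrite mul1r big_const_seq count_predT iter_mulr_1.
have /andP[? ?] := pM01.
rewrite ler_wiXn2l//.
rewrite -cardE; have := cardsC [set w | [set w]%SET \in L]%SET.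
rewrite card_ord; have := card_vertices_le L.
rewrite (_ : ~: _ = [set w | [set w]%SET \notin L]%SET); first by lia.
by apply/setP => w; rewrite !inE.
Qed.

Lemma measure_bigcup_seq_le (I : eqType) (s : seq I) (F : I -> set (subcomplex n)) :
  (P (\bigcup_(i in [set` s]) F i) <= \sum_(i <- s) P (F i))%E.
Proof.
elim: s => [|i s IHs].
  by rewrite big_nil (_ : [set` [::]] = set0) ?bigcup_set0 ?measure0//;
    apply/seteqP; split.
rewrite big_cons (_ : \bigcup_(_ in _) _ = F i `|` \bigcup_(i in [set` s]) F i).
  have := measureU2 P (subcomplex_measurable (F i))
    (subcomplex_measurable (\bigcup_(i in [set` s]) F i)).
  by move=> /le_trans; apply; exact: leeD2l.
apply/seteqP; split => X.
  by move=> [j /=]; rewrite inE => /predU1P[->|js]; [left|right; exists j].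
by move=> [Xi|[j /= js Xj]]; [exists i|exists j]; rewrite //= inE ?eqxx ?js ?orbT.
Qed.

Lemma lower_model_not_conic M :
  (P [set X : subcomplex n | ~ conic M X] <=
    (((n.+1 ^ (M * M))%N)%:R * (1 - p ^+ M) ^+ (n - M))%:E)%E.
Proof.
pose LL := [set L : {set {set 'I_n}} | is_subcomplex L & (#|L| < M)%N]%SET.
pose F (L : {set {set 'I_n}}) := [set X : subcomplex n |
  L \subset X /\ forall w, ~~ coned_by L X w].
apply: (@le_trans _ _ (P (\bigcup_(L in [set` enum LL]) F L))).
  apply: le_measure; rewrite ?inE//; try exact: subcomplex_measurable.
  move=> X /=; rewrite /conic => /existsNP[L] /not_implyP[hL] /not_implyP[LX].
  move=> /not_implyP[LM] nc; exists L; first by rewrite /= mem_enum inE hL.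
  by split => // w; apply/negP => h; apply: nc; exists w.
apply: le_trans (measure_bigcup_seq_le _ _) _.
apply: (@le_trans _ _ (\sum_(L <- enum LL) ((1 - p ^+ M) ^+ (n - M))%:E)%E).
  rewrite big_seq [leRHS]big_seq; apply: lee_sum => L.
  by rewrite mem_enum inE => /andP[hL LM]; exact: lower_model_not_coned.
rewrite sumEFin lee_fin big_const_seq count_predT iter_addr_0 -cardE.
rewrite -[leLHS]mulr_natl ler_wpM2r// ?ler_nat ?card_small_subcomplexes//.
by rewrite exprn_ge0// subr_ge0 exprn_ile1// ltW.
Qed.

End probability_bound.

(** * Asymptotic estimates and conclusion *)

(** Used with [y = ln n]. The quartic Taylor term gives [expR (y / 2) / 2 >= y^4 / 768], and the
    threshold on [y] makes this at least [(2 k^2 + 1) y^3 >= 2 k^2 y^3 + y]. *)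
Lemma pow_lin_le_expR_half (R : realType) (k y : R) : 0 <= k ->
  768%:R * (2 * k ^+ 2 + 1) + 1 <= y ->
  (k * y) ^+ 2 * (2 * y) - expR (y / 2) / 2 <= - y.
Proof.
move=> k0 hy; have k2 : 0 <= k ^+ 2 by exact: sqr_ge0.
have y1 : 1 <= y by lra.
have hexp : y ^+ 4 / 384%:R <= expR (y / 2).
  apply: le_trans (expR_ge1Dxn 3 _); last by rewrite divr_ge0//; lra.
  rewrite exprMn (_ : 4`! = 24)%N//.
  have : 0 <= y ^+ 4 by rewrite exprn_ge0//; lra.
  lra.
have y3 : y <= y ^+ 3.
  by rewrite -[leLHS]expr1 ler_weXn2l.
have hy4 : 768%:R * (2 * k ^+ 2 + 1) * y ^+ 3 <= y ^+ 4.
  by rewrite [leRHS]exprS ler_wpM2r//; [rewrite exprn_ge0//; lra|lra].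
have -> : (k * y) ^+ 2 * (2 * y) = 2 * k ^+ 2 * y ^+ 3 by ring.
lra.
Qed.

(** With [y = ln n]: [M <= k y] gives [p^M >= exp(-y/2)], so the second factor is at most
    [exp(-p^M (n - M)) <= exp(-exp(y/2) / 2)]. From [n + 1 <= n^2] the first is at most
    [exp(2 y (k y)^2)]. *)
Lemma union_bound_le (R : realType) (p : R) (n M : nat) :
  let k := (ln (p^-1 ^+ 2))^-1 in
  0 < p -> p < 1 -> (0 < n)%N -> M%:R <= k * ln n%:R ->
  768%:R * (2 * k ^+ 2 + 1) + 1 + 4 * k <= ln n%:R ->
  (n.+1 ^ (M * M))%N%:R * (1 - p ^+ M) ^+ (n - M) <= expR (- ln n%:R).
Proof.
move=> k p0 p1 n0; set y := ln n%:R => Mk hn. have q1 : 1 < p^-1 by rewrite invf_gt1.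
have lnq : 0 < ln p^-1 by rewrite ln_gt0.
have kE : k = (2 * ln p^-1)^-1.
  by rewrite /k lnXn ?invr_gt0// mulr2n mulrDl mul1r.
clearbody k.
have k0 : 0 < k by rewrite kE invr_gt0 mulr_gt0.
have k2 : 0 <= k ^+ 2 by exact: sqr_ge0.
have y1 : 1 <= y by lra.
have nR0 : 0 < n%:R :> R by rewrite ltr0n.
have nE : n%:R = expR y by rewrite lnK.
(* The summand [4 * k] of the threshold serves here: [k y <= y^2 / 4 <= exp(y) / 2]. *)
have Mn : M%:R <= n%:R / 2 :> R.
  apply: le_trans Mk _; rewrite nE.
  have : 1 + y ^+ 2 / 2%:R <= expR y by apply: (expR_ge1Dxn 1); lra.
  have : 4 * k * y <= y * y by rewrite ler_wpM2r//; lra.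
  rewrite expr2; lra.
have Mln : (M <= n)%N by rewrite -(ler_nat R); lra.
have pM : expR (- (y / 2)) <= p ^+ M.
  have -> : p = expR (- ln p^-1) by rewrite lnV// opprK lnK.
  rewrite -expRM_natl ler_expR mulrN lerN2.
  have : M%:R * (2 * ln p^-1) <= y.
    by rewrite -ler_pdivlMr ?mulr_gt0// -kE mulrC.
  lra.
have pM1 : 0 <= 1 - p ^+ M by rewrite subr_ge0 exprn_ile1// ltW.
have h1 : (1 - p ^+ M) ^+ (n - M) <= expR (- (expR (y / 2) / 2)).
  apply: (@le_trans _ _ (expR (- p ^+ M) ^+ (n - M))).
    by rewrite lerXn2r ?nnegrE ?expR_ge0//; exact: expR_ge1Dx.
  rewrite -expRM_natl ler_expR mulrN lerN2 natrB//.
  apply: (@le_trans _ _ (n%:R / 2 * expR (- (y / 2)))).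
    have : expR y * expR (- (y / 2)) = expR (y / 2) by rewrite -expRD; congr expR; lra.
    by rewrite nE mulrAC => ->.
  by apply: ler_pM => //; lra.
have h2 : (n.+1 ^ (M * M))%N%:R <= expR ((k * y) ^+ 2 * (2 * y)).
  have n2 : n.+1%:R <= expR (2 * y).
    rewrite expRM_natl -nE -natrX ler_nat.
    have n2 : (2 <= n)%N.
      by rewrite -(ltr_nat R) nE; apply: lt_le_trans (expR_ge1Dx _); lra.
    rewrite -mulnn; apply: leq_trans (leq_mul n2 (leqnn n)).
    by rewrite mul2n -addnn -addn1 leq_add2l.
  rewrite natrX; apply: le_trans (_ : expR (2 * y) ^+ (M * M) <= _).
    by rewrite lerXn2r// nnegrE ?expR_ge0.
  rewrite -expRM_natl ler_expR ler_wpM2r//; first by lra.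
  by rewrite natrM expr2 ler_pM.
apply: le_trans (ler_pM _ _ h2 h1) _ => //; first by rewrite exprn_ge0.
rewrite -expRD ler_expR; apply: pow_lin_le_expR_half; first exact: ltW.
by lra.
Qed.

Lemma conic_log_connected (R : realType) (q2 : R) n M (X : subcomplex n) :
  M = Num.truncn (log q2 (n%:R : R)) -> 1 <= log q2 (n%:R : R) -> conic M X ->
  complex_connected R (Num.floor (log 3 (log q2 n%:R) - 1)) X.
Proof.
set l := log q2 n%:R => -> l1 cX.
have le_trunc m : m%:R <= l -> (m <= Num.truncn l)%N.
  by move=> ml; rewrite truncn_ge_nat//; lra.
apply: conic_complex_connected; first by apply: subset_conic cX; exact: le_trunc.
move=> d; rewrite real_floor_ge_int ?num_real// => hd.
apply: subset_conic cX; apply: le_trunc; rewrite natrX.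
have ln3 : 0 < ln (3 : R) by rewrite ln_gt0// ltr1n.
rewrite -ler_ln ?posrE ?exprn_gt0//; last by lra.
rewrite lnXn// -[leLHS]mulr_natl -ler_pdivlMr// -natr1.
by rewrite -/(log 3 l); move: hd; rewrite -pmulrn; lra.
Qed.

Theorem corollary10 (R : realType) (p : R)
    (par : forall n : nat, {set 'I_n} -> R)
    (P : forall n : nat, probability (subcomplex n) R) :
  0 < p -> p < 1 ->
  (forall (n : nat) (s : {set 'I_n}), s != finset.set0 ->
     0 <= par n s <= 1) ->
  (forall (n : nat) (s : {set 'I_n}), s != finset.set0 -> p <= par n s) ->
  (forall n : nat, lower_model (par n) (P n)) ->
  let q := p^-1 in
  P n [set X : subcomplex n |
         complex_connected R
           (Num.floor (log 3 (log (q ^+ 2) n%:R) - 1)) X]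
    @[n --> \oo] --> 1%E.
Proof.
move=> p0 p1 par01 ppar hP q; pose k := (ln (q ^+ 2))^-1.
have k0 : 0 < k by rewrite invr_gt0 ln_gt0// exprn_egt1// invf_gt1.
(* The threshold of [union_bound_le], plus [k^-1] to ensure [log_{q^2} n >= 1], so that [M] is
   positive. *)
pose K := 768%:R * (2 * k ^+ 2 + 1) + 1 + 4 * k + k^-1.
have low : (1 - n%:R^-1 : R)%:E @[n --> \oo] --> 1%E.
  apply: cvg_EFin; first by near=> n.
  rewrite -[X in _ --> X]subr0; apply: cvgB; first exact: cvg_cst.
  apply/gtr0_cvgV0; last exact: cvgr_idn.
  by exists 1%N => // n /=; rewrite ltr0n.
apply: (squeeze_cvge _ low (cvg_cst 1%E)).
near=> n; apply/andP; split; last by apply: probability_le1.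
  have ln_n : K <= ln n%:R.
    have -> : K = ln (expR K) by rewrite expRK.
    have hn : expR K <= n%:R.
      near: n; exists (Num.bound (expR K)) => // m /= hm.
      rewrite (le_trans (ltW (archi_boundP (expR_ge0 K))))// ler_nat//.
    by rewrite ler_ln ?posrE ?expR_gt0// (lt_le_trans _ hn)// expR_gt0.
  have k2 : 0 <= k ^+ 2 by exact: sqr_ge0.
  have kV : 0 < k^-1 by rewrite invr_gt0.
  have n0 : (0 < n)%N.
    rewrite lt0n; apply/eqP => n0; move: ln_n; rewrite n0 ln0// /K; lra.
  have lE : log (q ^+ 2) n%:R = k * ln n%:R by rewrite /log mulrC.
  pose M := Num.truncn (log (q ^+ 2) (n%:R : R)).
  have l1 : 1 <= log (q ^+ 2) n%:R.
    by rewrite lE mulrC -ler_pdivrMr// div1r; apply: le_trans ln_n; rewrite /K; lra.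
  have Mk : M%:R <= k * ln n%:R.
    by rewrite -lE truncn_le//; lra.
  have bad : (P n [set X | ~ conic M X] <= (n%:R^-1)%:E)%E.
    apply: le_trans (@lower_model_not_conic _ _ _ _ (hP n) p p0 p1 _ M) _.
      by move=> s s0; rewrite ppar//; have /andP[] := par01 n s s0.
    rewrite lee_fin (le_trans (union_bound_le p0 p1 n0 Mk _))//.
      by apply: le_trans ln_n; rewrite /K -/q -/k; lra.
    by rewrite expRN lnK// posrE ltr0n.
  apply: (@le_trans _ _ (P n (~` [set X | ~ conic M X]))); last first.
    apply: le_measure; rewrite ?inE//.
    move=> X /= /contrapT cX; exact: conic_log_connected cX.
  rewrite probability_setC// EFinB leeB//.
Unshelve. all: by end_near.
Qed.
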